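(* Let $W_{\mathbf a}=(a_1,\dots,a_n;h)$ and $W_{\mathbf b}=(b_1,\dots,b_n;k)$ be reduced weight systems with $a_1\le\dots\le a_n$, $b_1\le\dots\le b_n$, $a_0:=h-\sum_{i=1}^n a_i>0$ and $b_0:=k-\sum_{i=1}^n b_i\neq0$. Let $C=(c_{ij})$ be a weighted magic square of weight $(W_{\mathbf a},W_{\mathbf b})$, assume that the matrix $B=(c_{ij}-1)$ is invertible, and let $A=B^{-1}$. Let $v_1=(1,0,\dots,0),\dots,v_n=(0,\dots,0,1)$ and $v_0=(-a_1/a_0,\dots,-a_n/a_0)$ be the vertices of the polar dual $\overline\Delta(\mathbf a)^\ast$, and let $\nabla$ be the convex hull of the vectors $v_1-v_0,\dots,v_n-v_0$ in $\mathbb R^n$. Then, in the coordinate system given by taking the columns of $A$ as basis vectors, $\nabla$ is the convex hull of the columns of $C$; hence $\nabla$ is, in these coordinates, a Newton diagram of the partner weight system $W_{\mathbf b}$.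
   Context: A weight system is a tuple of positive integers $(a_1,\dots,a_n;h)$; it is reduced if $\gcd(a_1,\dots,a_n)=1$. An $n\times n$ matrix $C$ with non-negative integer entries is a weighted magic square of weight $(W_{\mathbf a},W_{\mathbf b})$ if $C(a_1,\dots,a_n)^t=(h,\dots,h)^t$ and $(b_1,\dots,b_n)C=(k,\dots,k)$; then $C^t$ is a weighted magic square of weight $(W_{\mathbf b},W_{\mathbf a})$. For a weighted magic square $C$ of weight $(W_{\mathbf a},W_{\mathbf b})$, the simplex $\Gamma(\mathbf a)\subset\mathbb R^n$ which is the convex hull of the row vectors of $C$ is called a Newton diagram of $W_{\mathbf a}$; correspondingly the convex hull of the row vectors of $C^t$ (i.e. of the columns of $C$) is a Newton diagram of $W_{\mathbf b}$. $\overline\Delta(\mathbf a)$ is the $n$-simplex with vertices $(-1+h/a_1,-1,\dots,-1),\dots,(-1,\dots,-1,-1+h/a_n)$ and $(-1,\dots,-1)$. The polar dual of $M\subset\mathbb R^n$ is $M^\ast=\{y\in\mathbb R^n:\langle x,y\rangle\ge-1\text{ for all }x\in M\}$ with the Euclidean scalar product; it is known that $\overline\Delta(\mathbf a)^\ast$ is the $n$-simplex with vertices $v_0,v_1,\dots,v_n$ as in the claim. *)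

(* Defs.v *)
From HB Require Import structures.
From mathcomp Require Import all_boot all_order all_algebra.
From mathcomp Require Import all_classical all_reals all_analysis.

Set Implicit Arguments.
Unset Strict Implicit.
Unset Printing Implicit Defensive.

Import Order.TTheory GRing.Theory Num.Theory.
Local Open Scope classical_set_scope.
Local Open Scope ring_scope.

Record weight_system (n : nat) := WeightSystem {
  weight : 'cV[nat]_n ;
  degree : nat ;
  weight_gt0 : forall i : 'I_n, (0 < weight i ord0)%N ;
  degree_gt0 : (0 < degree)%N }.

Definition reduced n (W : weight_system n) : Prop :=
  \big[gcdn/0%N]_(i < n) weight W i ord0 = 1%N.

Definition nondecreasing_weights n (W : weight_system n) : Prop :=
  forall i j : 'I_n, (i <= j)%N -> (weight W i ord0 <= weight W j ord0)%N.

(* The integer a_0 = h - (a_1 + ... + a_n), which may be negative. *)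
Definition weight0 n (W : weight_system n) : int :=
  (degree W)%:Z - \sum_(i < n) (weight W i ord0)%:Z.

Definition weighted_magic_square n (Wa Wb : weight_system n) (C : 'M[nat]_n) :
    Prop :=
  C *m weight Wa = const_mx (degree Wa) /\
  (weight Wb)^T *m C = const_mx (degree Wb).

(* Points of R^n are column vectors throughout. *)
Section Geometry.
Variables (R : realType) (n : nat).

Definition conv_hull (X : set 'cV[R]_n) : set 'cV[R]_n :=
  smallest (@convex_set R 'cV[R]_n) X.

Definition affinely_independent m (v : 'I_m -> 'cV[R]_n) : Prop :=
  forall c : 'I_m -> R,
    \sum_(i < m) c i = 0 -> \sum_(i < m) c i *: v i = 0 -> forall i, c i = 0.

Definition simplex_with_vertices m (v : 'I_m -> 'cV[R]_n) (S : set 'cV[R]_n) :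
    Prop :=
  affinely_independent v /\ S = conv_hull (range v).

Definition polar_dual (M : set 'cV[R]_n) : set 'cV[R]_n :=
  [set y | forall x, M x -> -1 <= \sum_(i < n) x i ord0 * y i ord0].

(* Meaningful when the columns of A form a basis, i.e. when A is invertible. *)
Definition column_coordinates (A : 'M[R]_n) (y : 'cV[R]_n) : 'cV[R]_n :=
  \col_(i < n) coord [tuple col j A | j < n] i y.

Definition real_mx (C : 'M[nat]_n) : 'M[R]_n := map_mx (fun c => c%:R) C.

(* A Newton diagram depends on the choice of the partner weight system V and of
   the square C; row vectors are transposed since points are columns. *)
Definition newton_diagram (W : weight_system n) (G : set 'cV[R]_n) : Prop :=
  exists (V : weight_system n) (C : 'M[nat]_n),
    weighted_magic_square W V C /\
    simplex_with_vertices (fun i : 'I_n => (row i (real_mx C))^T) G.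

(* A family of n + 1 vertices v_0, v_1, ..., v_n is indexed by 'I_n.+1: v_0 has
   index ord0, and the vertex attached to coordinate j : 'I_n has index
   lift ord0 j. *)
Definition Delta_vertex (W : weight_system n) (i : 'I_n.+1) : 'cV[R]_n :=
  if unlift ord0 i is Some j then
    ((degree W)%:R / (weight W j ord0)%:R) *: delta_mx j ord0 - const_mx 1
  else - const_mx 1.

Definition Delta (W : weight_system n) : set 'cV[R]_n :=
  conv_hull (range (Delta_vertex W)).

Definition dual_vertex (W : weight_system n) (i : 'I_n.+1) : 'cV[R]_n :=
  if unlift ord0 i is Some j then delta_mx j ord0
  else \col_(j < n) - ((weight W j ord0)%:R / (weight0 W)%:~R).

Definition nabla (W : weight_system n) : set 'cV[R]_n :=
  conv_hull
    (range (fun i : 'I_n => dual_vertex W (lift ord0 i) - dual_vertex W ord0)).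

End Geometry.

Arguments real_mx R {n} C.
Arguments Delta_vertex R {n} W i.
Arguments Delta R {n} W.
Arguments dual_vertex R {n} W i.
Arguments nabla R {n} W.

(* Main.v *)
(* Taking coordinates with respect to the columns of [A] is multiplication by
   [B = C - 1], where [1] is the all-ones matrix.  The relations [C a = h] and
   [h - a_1 - ... - a_n = a_0] say exactly that [B v_0 = (-1, ..., -1)], so that
   [B (v_j - v_0)] is the [j]-th column of [B] plus [(1, ..., 1)], i.e. the
   [j]-th column of [C].  A linear relation with coefficients of sum [0] between
   the columns of [C] is one between the columns of [B], so these columns are
   affinely independent. *)

Require Import Defs.
From mathcomp Require Import all_boot all_order all_algebra.
From mathcomp Require Import all_classical all_reals all_analysis.
From mathcomp Require Import ring lra.
Set Implicit Arguments.
Unset Strict Implicit.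
Import Order.TTheory GRing.Theory Num.Theory.
Local Open Scope classical_set_scope.
Local Open Scope ring_scope.

(** * Convex sets, convex hulls and their linear images *)

Lemma convex_setP (R : numDomainType) (M : lmodType R) (A : set M) :
  convex_set (A : set (convex_lmodType M)) <->
  forall (x y : M) (t : R), 0 <= t -> t <= 1 -> A x -> A y ->
    A (t *: x + (1 - t) *: y).
Proof.
split=> [cA x y t t0 t1 Ax Ay | cA x y t /set_mem Ax /set_mem Ay].
  by have := cA x y (Itv01 t0 t1) (mem_set Ax) (mem_set Ay); move/set_mem.
by apply: mem_set; apply: cA.
Qed.

(** By induction on the list: the new barycentre combines [v i] with the barycentre of the tail,
    with coefficients [c i / (c i + s)] and [s / (c i + s)]. Normalising by the total, instead of
    assuming it to be 1, lets the induction hypothesis apply to the tail. *)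
Lemma convex_set_sum (R : numFieldType) (M : lmodType R) (A : set M)
    (I : Type) (r : seq I) (c : I -> R) (v : I -> M) :
  convex_set (A : set (convex_lmodType M)) ->
  (forall i, 0 <= c i) -> (forall i, A (v i)) -> 0 < \sum_(i <- r) c i ->
  A ((\sum_(i <- r) c i)^-1 *: \sum_(i <- r) c i *: v i).
Proof.
move=> /convex_setP cA c_ge0 Av; elim: r => [|i r IHr].
  by rewrite big_nil ltxx.
rewrite !big_cons; set s := \sum_(j <- r) c j in IHr *.
have s_ge0 : 0 <= s by exact: sumr_ge0.
move=> cs_gt0; have cs_neq0 := lt0r_neq0 cs_gt0.
(* A tail of total 0 cannot be normalised, but its nonnegative coefficients then all vanish and only
   [v i] remains. *)
have [s_eq0 | s_neq0] := eqVneq s 0.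
  have -> : \sum_(j <- r) c j *: v j = 0.
    elim: r @s {IHr s_ge0 cs_gt0 cs_neq0} s_eq0 => [|j r IHr] /=.
      by rewrite !big_nil.
    rewrite !big_cons => /eqP; rewrite paddr_eq0 ?sumr_ge0//.
    by case/andP=> /eqP-> /eqP /IHr->; rewrite scale0r addr0.
  move: cs_neq0; rewrite s_eq0 !addr0 => c_neq0.
  by rewrite scalerA mulVf// scale1r.
have s_gt0 : 0 < s by rewrite lt_def s_neq0.
have := cA (v i) (s^-1 *: \sum_(j <- r) c j *: v j) (c i / (c i + s)).
rewrite divr_ge0 ?(ltW cs_gt0)// ler_pdivrMr// mul1r lerDl s_ge0.
move=> /(_ isT isT (Av i) (IHr s_gt0)).
have -> : 1 - c i / (c i + s) = s / (c i + s) by field.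
by rewrite scalerA mulrAC mulfV// div1r scalerDr scalerA [_^-1 * c i]mulrC.
Qed.

Lemma conv_hull_convex (R : realType) (n : nat) (X : set 'cV[R]_n) :
  convex_set (conv_hull X : set (convex_lmodType 'cV[R]_n)).
Proof.
apply/convex_setP => x y t t0 t1 Xx Xy S [/= cS XS].
by move/convex_setP: (cS); apply=> //; [exact: Xx | exact: Xy].
Qed.

(** The combinations on the right form a convex set containing every [v i], which gives one
    inclusion by minimality of the hull; the other is [convex_set_sum] with total 1. *)
Lemma conv_hull_range (R : realType) (n m : nat) (v : 'I_m -> 'cV[R]_n) :
  conv_hull (range v) =
  [set y | exists c : 'I_m -> R, [/\ forall i, 0 <= c i, \sum_i c i = 1
                                   & y = \sum_i c i *: v i]].
Proof.
apply/seteqP; split=> [| y [c [c_ge0 c1 ->]]].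
  apply: smallest_sub => [| _ [i _ <-]]; last first.
    exists (fun j => (j == i)%:R); split=> [j | |]; first exact: ler0n.
      by rewrite (bigD1 i)//= eqxx big1 ?addr0// => j /negPf->.
    rewrite (bigD1 i)//= eqxx scale1r big1 ?addr0// => j /negPf->.
    by rewrite scale0r.
  apply/convex_setP => _ _ t t0 t1 [c [c_ge0 c1 ->]] [d [d_ge0 d1 ->]].
  exists (fun i => t * c i + (1 - t) * d i); split=> [i | |].
  - by rewrite addr_ge0 ?mulr_ge0 ?subr_ge0.
  - by rewrite big_split/= -!mulr_sumr c1 d1; ring.
  - rewrite !scaler_sumr -big_split/=; apply: eq_bigr => i _.
    by rewrite !scalerA -scalerDl.
have := @convex_set_sum _ _ _ _ (index_enum 'I_m) c v
  (@conv_hull_convex R n (range v)) c_ge0.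
rewrite c1 invr1 scale1r; apply=> // i.
by apply: sub_gen_smallest; exists i.
Qed.

Lemma conv_hull_image (R : realType) (n p m : nat) (B : 'M[R]_(p, n))
    (v : 'I_m -> 'cV[R]_n) :
  mulmx B @` conv_hull (range v) = conv_hull (range (fun i => B *m v i)).
Proof.
have BE c : B *m (\sum_i c i *: v i) = \sum_i c i *: (B *m v i).
  by rewrite mulmx_sumr; apply: eq_bigr => i _; rewrite scalemxAr.
rewrite !conv_hull_range; apply/seteqP; split=> [_ [_ [c [c0 c1 ->]] <-] | ].
  by exists c; rewrite BE.
by move=> _ [c [c0 c1 ->]]; exists (\sum_i c i *: v i); [exists c | exact: BE].
Qed.

(** * Polar duals *)

Lemma polar_dual_convex (R : realType) (n : nat) (M : set 'cV[R]_n) :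
  convex_set (polar_dual M : set (convex_lmodType 'cV[R]_n)).
Proof.
apply/convex_setP => y z t t0 t1 My Mz x Mx.
have -> : \sum_(i < n) x i ord0 * (t *: y + (1 - t) *: z) i ord0 =
    t * (\sum_(i < n) x i ord0 * y i ord0) +
    (1 - t) * (\sum_(i < n) x i ord0 * z i ord0).
  rewrite !mulr_sumr -big_split; apply: eq_bigr => i _ /=.
  by rewrite !mxE; ring.
by move: (My x Mx) (Mz x Mx); nra.
Qed.

Lemma polar_dual_conv_hull (R : realType) (n : nat) (X : set 'cV[R]_n) :
  polar_dual (conv_hull X) = polar_dual X.
Proof.
have inC (x y : 'cV[R]_n) :
    \sum_(i < n) x i ord0 * y i ord0 = \sum_(i < n) y i ord0 * x i ord0.
  by apply: eq_bigr => i _; rewrite mulrC.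
apply/seteqP; split=> y Xy x Xx; first by apply: Xy; exact: sub_gen_smallest.
(* By symmetry of the scalar product, [y] lies in the dual of [X] exactly when [X] lies in the dual
   of the point [y]; the latter is convex, so it also contains the hull of [X]. *)
rewrite inC; apply: (Xx (polar_dual [set y])) => //; split=> [| z Xz _ ->].
  exact: polar_dual_convex.
by rewrite inC; exact: Xy.
Qed.

(** * Coordinates with respect to the columns of a matrix *)

Lemma column_coordinatesE (R : realType) (n : nat) (A : 'M[R]_n)
    (y : 'cV[R]_n) :
  A \in unitmx -> column_coordinates A y = invmx A *m y.
Proof.
move=> Au; set X := [tuple col j A | j < n].
have XE (z : 'cV[R]_n) : \sum_i z i ord0 *: X`_i = A *m z.
  apply/matrixP => i j; rewrite summxE mxE; apply: eq_bigr => k _.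
  by rewrite -tnth_nth tnth_mktuple !mxE mulrC (ord1 j).
have freeX : free X.
  apply/freeP => k kX i.
  have: A *m (\col_j k j) = 0.
    by rewrite -XE -[RHS]kX; apply: eq_bigr => j _; rewrite mxE.
  move/(canRL (mulKmx Au)); rewrite mulmx0 => /matrixP/(_ i ord0).
  by rewrite !mxE.
apply/matrixP => i j; rewrite mxE (ord1 j).
(* Writing [y] as [A *m (invmx A *m y)] displays it as a combination of the columns; freeness
   identifies the coefficients with the coordinates. *)
by rewrite -{1}(mulKVmx Au y) -XE coord_sum_free.
Qed.

(** * The simplex of a weight system and its polar dual *)

Section WeightSystem.
Variables (R : realType) (n : nat) (W : weight_system n).

Local Notation a i := ((weight W i ord0)%:R : R).
Local Notation a0 := ((weight0 W)%:~R : R).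
Local Notation h := ((degree W)%:R : R).

Lemma degreeE : h = a0 + \sum_i a i.
Proof. by rewrite /weight0 rmorphB rmorph_sum/= subrK. Qed.

Lemma dual_vertex0 : dual_vertex R W ord0 = \col_j - (a j / a0).
Proof. by rewrite /dual_vertex unlift_none. Qed.

Lemma dual_vertex_lift j : dual_vertex R W (lift ord0 j) = delta_mx j ord0.
Proof. by rewrite /dual_vertex liftK. Qed.

Lemma dual_vertex_sumE (c : 'I_n.+1 -> R) i :
  (\sum_k c k *: dual_vertex R W k) i ord0 =
  c (lift ord0 i) - c ord0 * (a i / a0).
Proof.
rewrite big_ord_recl dual_vertex0 !mxE summxE mulrN addrC; congr (_ - _).
rewrite (bigD1 i)//= dual_vertex_lift !mxE !eqxx mulr1 big1 ?addr0// => j ji.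
by rewrite dual_vertex_lift !mxE eq_sym (negPf ji) mulr0.
Qed.

(** Duality needs testing only at the vertices: [(-1, ..., -1)] gives the first inequality, and the
    vertex attached to coordinate [j] gives the inequality indexed by [j]. *)
Lemma polar_dual_Delta (y : 'cV[R]_n) :
  polar_dual (Delta R W) y <->
  \sum_i y i ord0 <= 1 /\
  forall j, -1 <= h / a j * y j ord0 - \sum_i y i ord0.
Proof.
have D0 : \sum_i Delta_vertex R W ord0 i ord0 * y i ord0 = - \sum_i y i ord0.
  rewrite -sumrN; apply: eq_bigr => i _.
  by rewrite /Delta_vertex unlift_none !mxE mulN1r.
have DS j : \sum_i Delta_vertex R W (lift ord0 j) i ord0 * y i ord0 =
    h / a j * y j ord0 - \sum_i y i ord0.
  rewrite /Delta_vertex liftK (bigD1 j)//= [in RHS](bigD1 j)//= opprD addrA.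
  rewrite !mxE !eqxx mulr1 mulrBl mul1r; congr (_ + _).
  rewrite -sumrN; apply: eq_bigr => i /negPf ij.
  by rewrite !mxE ij mulr0 sub0r mulN1r.
rewrite /Delta polar_dual_conv_hull; split=> [Dy | [y1 yj] _ [i _ <-]].
  split; last by move=> j; rewrite -DS; apply: Dy; exists (lift ord0 j).
  by rewrite -lerN2 -D0; apply: Dy; exists ord0.
by case: (unliftP ord0 i) => [j|] ->; rewrite ?D0 ?lerN2// DS.
Qed.

Hypothesis a0_gt0 : 0 < weight0 W.

Let a0R_gt0 : 0 < a0. Proof. by rewrite ltr0z. Qed.

Let a_gt0 i : 0 < a i. Proof. by rewrite ltr0n weight_gt0. Qed.

Let h_gt0 : 0 < h. Proof. by rewrite ltr0n degree_gt0. Qed.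

(** A linear relation forces [c_j = c_0 a_j / a_0], so the coefficients sum to [c_0 h / a_0]; as [h]
    is nonzero, sum 0 gives [c_0 = 0], and the others follow. *)
Lemma dual_vertex_affinely_independent :
  affinely_independent (dual_vertex R W).
Proof.
have a0n := lt0r_neq0 a0R_gt0.
move=> c c_sum cv.
have cS i : c (lift ord0 i) = c ord0 * (a i / a0).
  by apply/eqP; rewrite -subr_eq0 -dual_vertex_sumE cv mxE.
have c0 : c ord0 = 0.
  move: c_sum; rewrite big_ord_recl (eq_bigr _ (fun i _ => cS i)) -mulr_sumr.
  rewrite -mulr_suml.
  have -> : c ord0 + c ord0 * ((\sum_i a i) / a0) = c ord0 * (h / a0).
    by rewrite degreeE; field.
  by move/eqP; rewrite mulf_eq0 mulf_eq0 invr_eq0 (negPf a0n) (gt_eqF h_gt0)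
    !orbF => /eqP.
by move=> i; case: (unliftP ord0 i) => [j|] ->//; rewrite cS c0 mul0r.
Qed.

(* The barycentric coordinates of [y] with respect to the [v_i] are
   [a_0 (1 - s) / h] and [y_j + a_j (1 - s) / h], where [s] is the sum of the
   entries of [y]; their signs are the inequalities defining the polar dual. *)
Lemma polar_dual_Delta_conv_hull :
  polar_dual (Delta R W) = conv_hull (range (dual_vertex R W)).
Proof.
have a0n := lt0r_neq0 a0R_gt0; have hn := lt0r_neq0 h_gt0.
apply/seteqP; split=> [y /polar_dual_Delta[] |].
  set s := \sum_i y i ord0 => s_le1 yP; rewrite conv_hull_range.
  pose c (k : 'I_n.+1) := if unlift ord0 k is Some j
    then y j ord0 + a j * (1 - s) / h else a0 * (1 - s) / h.
  have c0 : c ord0 = a0 * (1 - s) / h by rewrite /c unlift_none.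
  have cS j : c (lift ord0 j) = y j ord0 + a j * (1 - s) / h.
    by rewrite /c liftK.
  exists c; split=> [k | |].
  - case: (unliftP ord0 k) => [j|] ->; last first.
      by rewrite c0 divr_ge0 ?mulr_ge0 ?subr_ge0// ltW.
    have ajn := lt0r_neq0 (a_gt0 j).
    have -> : c (lift ord0 j) = a j / h * (h / a j * y j ord0 - s + 1).
      by rewrite cS; field; apply/andP.
    by rewrite mulr_ge0 ?divr_ge0 ?(ltW h_gt0) ?(ltW (a_gt0 j))// -lerBlDr sub0r.
  - rewrite big_ord_recl c0 (eq_bigr _ (fun j _ => cS j)) big_split/= -/s.
    rewrite -!mulr_suml.
    have -> : \sum_i a i = h - a0 by rewrite degreeE [a0 + _]addrC addrK.
    by field.
  - apply/matrixP => i j; rewrite (ord1 j) dual_vertex_sumE c0 cS.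
    by field; apply/andP.
(* Conversely, the dual is convex, so it suffices that it contains each vertex. At [v_l] the entries
   sum to 1, and the remaining inequalities only say that [h / a_j] times an entry 0 or 1 is
   nonnegative. *)
apply: smallest_sub => [|_ [k _ <-]]; first exact: polar_dual_convex.
apply/polar_dual_Delta; case: (unliftP ord0 k) => [l|] ->.
  rewrite dual_vertex_lift.
  have -> : \sum_i (delta_mx l ord0 : 'cV[R]_n) i ord0 = 1.
    rewrite (bigD1 l)//= mxE !eqxx big1 ?addr0// => i /negPf il.
    by rewrite mxE il.
  split=> // j; rewrite lerDr !mxE.
  by rewrite mulr_ge0 ?divr_ge0 ?(ltW h_gt0) ?(ltW (a_gt0 j))// ler0n.
(* At [v_0] the inequalities indexed by [j] are all equalities, and the first one holds because
   [h / a_0] is nonnegative. *)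
rewrite dual_vertex0.
have -> : \sum_i (\col_j - (a j / a0) : 'cV[R]_n) i ord0 = 1 - h / a0.
  under eq_bigr do rewrite mxE.
  by rewrite sumrN -mulr_suml degreeE; field.
split=> [|j]; first by rewrite gerDl oppr_le0 divr_ge0 ?ltW.
have ajn := lt0r_neq0 (a_gt0 j).
rewrite mxE [leRHS](_ : _ = -1)//; field; exact/andP.
Qed.

End WeightSystem.

(** * The action of [C - 1] on the dual vertices *)

Section MagicSquare.
Variables (R : realType) (n : nat) (Wa Wb : weight_system n) (C : 'M[nat]_n).
Hypothesis magicC : weighted_magic_square Wa Wb C.

Lemma weighted_magic_square_tr : weighted_magic_square Wb Wa C^T.
Proof.
case: magicC => Ca bC; split.
  by apply: trmx_inj; rewrite trmx_mul trmxK bC trmx_const.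
by apply: trmx_inj; rewrite trmx_mul !trmxK Ca trmx_const.
Qed.

Local Notation B := (\matrix_(i < n, j < n) ((C i j)%:R - 1) : 'M[R]_n).

Lemma pred_mx_dual_vertex0 :
  weight0 Wa != 0 -> B *m dual_vertex R Wa ord0 = const_mx (-1).
Proof.
move=> a0_neq0; have a0n : (weight0 Wa)%:~R != 0 :> R by rewrite intr_eq0.
apply/matrixP => i j; rewrite dual_vertex0 !mxE.
have Ca : \sum_k (C i k)%:R * (weight Wa k ord0)%:R = (degree Wa)%:R :> R.
  case: magicC => /matrixP/(_ i ord0); rewrite !mxE => <- _.
  by rewrite natr_sum; apply: eq_bigr => k _; rewrite natrM.
under eq_bigr do rewrite !mxE mulrN mulrA mulrBl mul1r.
rewrite sumrN -mulr_suml sumrB Ca degreeE; field.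
exact: a0n.
Qed.

Lemma pred_mx_dual_vertexB j :
  weight0 Wa != 0 ->
  B *m (dual_vertex R Wa (lift ord0 j) - dual_vertex R Wa ord0) =
  col j (real_mx R C).
Proof.
move=> a0_neq0; rewrite mulmxBr pred_mx_dual_vertex0// dual_vertex_lift -colE.
by apply/matrixP => i k; rewrite !mxE opprK subrK.
Qed.

Lemma col_affinely_independent :
  B \in unitmx -> affinely_independent (fun j => col j (real_mx R C)).
Proof.
move=> Bu c c0 cC i.
have: B *m (\col_j c j) = 0.
  apply/matrixP => k l; rewrite !mxE.
  under eq_bigr do rewrite !mxE mulrBl mul1r.
  move/matrixP/(_ k ord0): cC; rewrite summxE [RHS]mxE => cCk.
  rewrite sumrB c0 subr0 -[RHS]cCk.
  by apply: eq_bigr => j _; rewrite !mxE mulrC.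
move/(canRL (mulKmx Bu)); rewrite mulmx0 => /matrixP/(_ i ord0).
by rewrite !mxE.
Qed.

End MagicSquare.

Theorem proposition1 (R : realType) (n : nat) (Wa Wb : weight_system n)
    (C : 'M[nat]_n) (B A : 'M[R]_n)
    (redWa : reduced Wa) (redWb : reduced Wb)
    (incWa : nondecreasing_weights Wa) (incWb : nondecreasing_weights Wb)
    (a0_gt0 : 0 < weight0 Wa) (b0_neq0 : weight0 Wb != 0)
    (magicC : weighted_magic_square Wa Wb C)
    (defB : B = \matrix_(i < n, j < n) ((C i j)%:R - 1))
    (unitB : B \in unitmx)
    (defA : A = invmx B) :
  [/\ simplex_with_vertices (dual_vertex R Wa) (polar_dual (Delta R Wa)),
      column_coordinates A @` nabla R Wa =
        conv_hull (range (fun j : 'I_n => col j (real_mx R C)))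
    & newton_diagram Wb (column_coordinates A @` nabla R Wa)].
Proof.
have coordsE : column_coordinates A = mulmx B.
  apply/funext => y.
  by rewrite column_coordinatesE defA ?unitmx_inv// invmxK.
have nablaE : column_coordinates A @` nabla R Wa =
    conv_hull (range (fun j : 'I_n => col j (real_mx R C))).
  rewrite coordsE conv_hull_image defB.
  under eq_fun do rewrite (pred_mx_dual_vertexB R magicC) ?gt_eqF//.
  by [].
split=> //.
  split; first exact: dual_vertex_affinely_independent.
  exact: polar_dual_Delta_conv_hull.
(* The partner of [Wb] is [Wa]: the rows of [C^T], which is a square of weight [(Wb, Wa)], are the
   columns of [C]. *)
exists Wa, C^T; split; first exact: weighted_magic_square_tr.
have -> : (fun i => (row i (real_mx R C^T))^T) =
    (fun j => col j (real_mx R C)).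
  by apply/funext => j; apply/matrixP => i k; rewrite !mxE.
split; last exact: nablaE.
by apply: col_affinely_independent; rewrite -defB.
Qed.
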